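(* Let $0\le\rho<\lambda\le1$ and, for each $\alpha\in[0,1]$, let $R^\alpha_t$ be the second class particle initially at the origin for the process $\eta^\alpha_t$. Then, almost surely, for all $t\ge0$ and $x\in\mathbb Z$, $$\eta^{\lambda,\rho}_t(x)=\begin{cases}\eta^\rho_t(x)&\text{if }x>R^\rho_t,\\ \eta^\lambda_t(x)&\text{if }x<R^\lambda_t.\end{cases}$$ Furthermore, for every $\alpha$ with $\lambda\ge\alpha\ge\rho$, almost surely, for all $t\ge 0$, $$\eta^{\lambda,\rho}_t(x)\le\eta^\alpha_t(x)\quad\text{for } x>R^\alpha_t,\qquad\qquad \eta^\alpha_t(x)\le\eta^{\lambda,\rho}_t(x)\quad\text{for } x<R^\alpha_t.$$
   Context: Configurations are elements $\eta\in\{0,1\}^{\mathbb Z}$; $\eta(x)=1$ means there is a particle at site $x$, and $\eta(x)=0$ a hole. Tasep (graphical construction): let $\omega$ be a rate-1 Poisson process on $\mathbb Z\times\mathbb R^+$ (for each $x$, the times $t$ with $(x,t)\in\omega$ form a rate-1 Poisson process, independently over $x$). If $(x,t)\in\omega$ there is an arrow $x\to x+1$ at time $t$. Given an initial configuration $\eta$, at each arrow $(x,t)$, if just before $t$ there is a particle at $x$ and a hole at $x+1$, the particle jumps to $x+1$; otherwise nothing changes. For almost every $\omega$, for each $T>0$ the line splits into finite boxes with no arrows between boxes during $(0,T)$, so this defines a configuration $\eta_t[\eta,\omega]$ for all $t\ge0$ and all $\eta$. Let $U=(U(x))_{x\in\mathbb Z}$ be i.i.d. uniform on $[0,1]$,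 independent of $\omega$; the same $U$ and $\omega$ are used for all processes and all parameters, and almost surely refers to the joint law of $(U,\omega)$. For $\alpha\in[0,1]$, $\eta^\alpha(x)=\mathbf 1\{U(x)<\alpha\}$ and $\eta^\alpha_t=\eta_t[\eta^\alpha,\omega]$. Also $\eta^{\lambda,\rho}(x)=\mathbf 1\{U(x)\le\lambda\}$ for $x\le0$, $\eta^{\lambda,\rho}(x)=\mathbf 1\{U(x)\le\rho\}$ for $x>0$, and $\eta^{\lambda,\rho}_t=\eta_t[\eta^{\lambda,\rho},\omega]$. For a configuration $\eta$, let $\tilde\eta$ be the configuration equal to $\eta$ off the origin with $\tilde\eta(0)=1$, and $\underline{\eta}$ the configuration equal to $\eta$ off the origin with $\underline{\eta}(0)=0$. Write $\tilde\eta^\alpha_t=\eta_t[\tilde\eta^\alpha,\omega]$, $\underline{\eta}^\alpha_t=\eta_t[\underline{\eta}^\alpha,\omega]$. Almost surely these two configurations differ at exactly one site for every $t\ge0$; $R^\alpha_t$ denotes that site (so $R^\alpha_0=0$). *)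

(* Defs.v *)
From HB Require Import structures.
From mathcomp Require Import all_boot all_order all_algebra finmap.
From mathcomp Require Import all_classical all_reals all_analysis measurable_realfun.

Set Implicit Arguments.
Unset Strict Implicit.
Unset Printing Implicit Defensive.

Import Order.TTheory GRing.Theory Num.Theory.

Local Open Scope classical_set_scope.
Local Open Scope ring_scope.

Definition config := int -> bool.

Definition with_particle (eta : config) : config :=
  fun x => if x == 0 then true else eta x.

Definition with_hole (eta : config) : config :=
  fun x => if x == 0 then false else eta x.

Definition jump (x : int) (eta : config) : config :=
  if eta x && ~~ eta (x + 1) then
    fun y => if y == x then false else if y == x + 1 then true else eta y
  else eta.

Section GraphicalConstruction.
Variable R : realType.
Implicit Types (om : set (int * R)) (t : R) (a b x : int).

(* no arrow a -> a + 1 during the time interval ]0, t] *)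
Definition quiet om t a : Prop := forall s, 0 < s <= t -> ~ om (a, s).

(* The pair (a, b) stands for the box of sites {a + 1, ..., b}. *)
Definition is_box om t x (ab : int * int) : Prop :=
  ab.1 < x <= ab.2 /\ quiet om t ab.1 /\ quiet om t ab.2.

(* Almost surely every site has a box, and the evolution does not depend on
   which one is chosen. The default box {x}, which contains no arrow, is only
   used for the exceptional om. *)
Definition box om t x : int * int := xget (x - 1, x) (is_box om t x).

Definition box_arrows om t (ab : int * int) : set (int * R) :=
  [set p | om p /\ ab.1 < p.1 < ab.2 /\ 0 < p.2 <= t].

(* Almost surely box_arrows is finite (fset_set sends infinite sets to the
   empty one) and its times are distinct, so that the sorted list is unique. *)
Definition box_arrow_seq om t (ab : int * int) : seq (int * R) :=
  sort (fun p q : int * R => p.2 <= q.2) (fset_set (box_arrows om t ab)).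

Definition tasep (eta : config) om t : config := fun x =>
  foldl (fun xi p => jump p.1 xi) eta (box_arrow_seq om t (box om t x)) x.

Definition second_class (eta : config) om t : int :=
  xget 0 [set x | tasep (with_particle eta) om t x
               != tasep (with_hole eta) om t x].

Definition eta_hom (u : int -> R) (alpha : R) : config :=
  fun x => u x < alpha.

Definition eta_step (u : int -> R) (lambda rho : R) : config :=
  fun x => if x <= 0 then u x <= lambda else u x <= rho.

End GraphicalConstruction.

Section Randomness.
Context (R : realType) (d : measure_display) (T : measurableType d).
Variable P : probability T R.

Definition independent2 (F G : set (set T)) : Prop :=
  forall A B, F A -> G B -> P (A `&` B) = (P A * P B)%E.

Definition mutually_independent (I : choiceType) (F : I -> set (set T)) :
  Prop :=
  forall (J : {fset I}) (A : I -> set T),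
    (forall i, i \in J -> F i (A i)) ->
    P (\bigcap_(i in [set` J]) A i) = (\prod_(i <- J) P (A i))%E.

Definition sigma_gen d' (T' : measurableType d') (X : T -> T') :
  set (set T) := preimage_set_system setT X measurable.

Definition npoints (pts : T -> set R) (B : set R) (w : T) : \bar R :=
  counting (pts w `&` B).

Definition borel_pos (B : set R) : Prop :=
  measurable B /\ B `<=` [set s | 0 <= s].

(* The Poisson probabilities are written out because poisson_pmf does not
   give the Dirac mass at 0 when its parameter is 0. *)
Record rate1_poisson (pts : T -> set R) : Prop := {
  poisson_pos : forall w, pts w `<=` [set s | 0 <= s] ;
  poisson_meas : forall B, borel_pos B -> measurable_fun setT (npoints pts B) ;
  poisson_law : forall B, borel_pos B -> (lebesgue_measure B < +oo)%E ->
    forall k : nat,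
      let m : R := fine (lebesgue_measure B) in
      P [set w | npoints pts B w = k%:R%:E] =
        (expR (- m) * m ^+ k / k`!%:R)%:E ;
  poisson_indep : forall (n : nat) (B : 'I_n -> set R),
    (forall i, borel_pos (B i)) -> trivIset setT B ->
    mutually_independent (fun i => sigma_gen (npoints pts (B i))) }.

Definition sigma_points (pts : T -> set R) : set (set T) :=
  <<s \bigcup_(B in borel_pos) sigma_gen (npoints pts B) >>.

Definition line (om : T -> set (int * R)) (x : int) : T -> set R :=
  fun w => [set s | om w (x, s)].

Record poisson_arrows (om : T -> set (int * R)) : Prop := {
  arrows_poisson : forall x, rate1_poisson (line om x) ;
  arrows_indep : mutually_independent (fun x => sigma_points (line om x)) }.

Record iid_uniform (U : int -> {RV P >-> R}) : Prop := {
  uniform_law : forall x (B : set R), measurable B ->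
    distribution P (U x) B = uniform_prob (@ltr01 R) B ;
  uniform_indep : mutually_independent (fun x => sigma_gen (U x)) }.

Definition sigma_uniforms (U : int -> {RV P >-> R}) : set (set T) :=
  <<s \bigcup_x sigma_gen (U x) >>.

Definition sigma_arrows (om : T -> set (int * R)) : set (set T) :=
  <<s \bigcup_x sigma_points (line om x) >>.

End Randomness.

(* Main.v *)
Require Import Defs.
From HB Require Import structures.
From mathcomp Require Import all_boot all_order all_algebra finmap.
From mathcomp Require Import zify lra.
From mathcomp Require Import all_classical all_reals all_analysis measurable_realfun.
Set Implicit Arguments.
Unset Strict Implicit.
Unset Printing Implicit Defensive.
Import Order.TTheory GRing.Theory Num.Theory.
Import numFieldNormedType.Exports.
Local Open Scope classical_set_scope.
Local Open Scope ring_scope.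

(** The second class particle of [eta] separates two regions. A step
configuration [zeta] with densities [lambda >= alpha >= rho] lies above the
density [alpha] configuration [eta] on the left of the origin and below it on
the right, and the claim is that the place where this comparison changes sign
is carried along by the second class particle. It suffices to check one arrow
([jump_crosses]). If neither endpoint of the arrow is the second class
particle, both endpoints lie on the same side of it and the comparison there
survives by attractiveness. If the second class particle moves, it leaves
behind a value for which the comparison holds whatever [zeta] is: a particle
of [eta] on its right when it steps left, a hole of [eta] on its left when it
steps right. If it is an endpoint and stays, it faces a particle on its right
or a hole on its left, so the same remark applies to the other endpoint.

Taking [alpha = rho], attractiveness ([tasep_homo]) also gives
[eta <= zeta] everywhere, so that [zeta <= eta] on the right of the second
class particle is an equality; [alpha = lambda] is symmetric. The first half
of the theorem thus follows from the second half and monotonicity.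

The rest is the passage from lists of arrows to the graphical construction.
The value at each site is computed in a box chosen for that site alone, so the
values at [x] and at the second class particle have to be brought into one
common box: [tasep_any_box] shows that any box gives the same
result, provided that the arrows are [regular] up to time [t]. Almost sure
regularity ([ae_regular]) has three sources. Quiet sites exist on both sides
because the events that distinct lines carry no arrow before a given time are
independent with the same positive probability ([ae_exists_quiet]). The number
of arrows is finite because Poisson probabilities sum to one
([ae_finite_points]). Two lines share no time because, after cutting the time
interval into pieces of length [1 / M], the expected number of pieces
containing points of both lines is of order [1 / M] ([ae_no_simultaneous]).
Finally, the strict and large inequalities in the two kinds of initial
configuration are reconciled by the fact that almost surely no [U x] equals
[rho] or [lambda] ([ae_uniform_neq]). *)

(** * One arrow *)

Lemma jumpE (x : int) (eta : config) (y : int) :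
  jump x eta y = if y == x then eta x && eta (x + 1)
                 else if y == x + 1 then eta x || eta (x + 1) else eta y.
Proof.
rewrite /jump; case: ifPn => [/andP[ex ex1]|]; last rewrite negb_and negbK.
- by rewrite ex (negbTE ex1).
- case: eqVneq => [->|_]; first by case: (eta x); case: (eta _).
  by case: eqVneq => [->|_ //]; case: (eta x); case: (eta _).
Qed.

Lemma jump_homo (x : int) (eta xi : config) :
  (forall y, eta y -> xi y) -> forall y, jump x eta y -> jump x xi y.
Proof.
move=> le y; rewrite !jumpE; case: ifP => _.
  by move=> /andP[/le -> /le ->].
by case: ifP => _; [case/orP=> /le ->; rewrite ?orbT | exact: le].
Qed.

Definition differ_only_at (r : int) (xi1 xi0 : config) : Prop :=
  [/\ xi1 r, ~~ xi0 r & forall y, y != r -> xi1 y = xi0 y].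

(** The direction is that of [xi] a homogeneous configuration and [zeta] a
step configuration with more particles on the left. *)
Definition crosses_at (r : int) (xi zeta : config) : Prop :=
  (forall y, r < y -> zeta y -> xi y) /\ (forall y, y < r -> xi y -> zeta y).

(** When the arrow starts at [r] the second class particle follows it if the
target is empty; when the arrow ends at [r], a particle coming from the left
overtakes it and pushes it one step back. In every case the endpoint other
than the new position holds, in the jumped [xi0], a particle if it lies on the
right and a hole if it lies on the left, so that nothing has to be known about
[zeta] there. *)
Lemma jump_crosses (x r : int) (xi1 xi0 zeta : config) :
  differ_only_at r xi1 xi0 -> crosses_at r xi0 zeta ->
  exists r', differ_only_at r' (jump x xi1) (jump x xi0) /\
             crosses_at r' (jump x xi0) (jump x zeta).
Proof.
move=> [h1 h0 heq] [hR hL].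
have [xr|xr] := eqVneq x r.
  subst x.
  have e1 : xi1 (r + 1) = xi0 (r + 1) by apply: heq; lia.
  have z1 : zeta (r + 1) -> xi0 (r + 1) by apply: hR; lia.
  case E : (xi0 (r + 1)).
  - exists r; split; split.
    + by rewrite jumpE eqxx h1 e1 E.
    + by rewrite jumpE eqxx (negbTE h0).
    + move=> y yr; rewrite !jumpE (negbTE yr) h1 E orbT /=.
      by case: eqVneq => // ?; exact: heq.
    + move=> y ry; rewrite !jumpE gt_eqF// E orbT.
      by case: eqVneq => // ?; exact: hR.
    + move=> y yr; rewrite !jumpE lt_eqF// lt_eqF; last by lia.
      exact: hL.
  - move: z1; rewrite E => z1.
    exists (r + 1); split; split.
    + by rewrite jumpE eqxx h1 gt_eqF//; lia.
    + by rewrite jumpE eqxx (negbTE h0) E gt_eqF//; lia.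
    + move=> y yr; rewrite !jumpE (negbTE yr) e1 E !andbF.
      by case: eqVneq => // ?; exact: heq.
    + move=> y ry; rewrite !jumpE gt_eqF; last by lia.
      rewrite gt_eqF//; apply: hR; lia.
    + move=> y yr; rewrite !jumpE (lt_eqF yr) E andbF.
      case: eqVneq => // ?; apply: hL; lia.
have [xr1|xr1] := eqVneq (x + 1) r.
  subst r.
  have e1 : xi1 x = xi0 x by apply: heq; lia.
  have z1 : xi0 x -> zeta x by apply: hL; lia.
  case E : (xi0 x).
  - exists x; split; split.
    + by rewrite jumpE eqxx h1 e1 E.
    + by rewrite jumpE eqxx (negbTE h0) andbF.
    + move=> y yr; rewrite !jumpE (negbTE yr) e1 E.
      by case: eqVneq => // ?; exact: heq.
    + move=> y ry; rewrite !jumpE (gt_eqF ry) E.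
      case: eqVneq => // ?; apply: hR; lia.
    + move=> y yr; rewrite !jumpE (lt_eqF yr) lt_eqF; last by lia.
      apply: hL; lia.
  - exists (x + 1); split; split.
    + by rewrite jumpE eqxx h1 orbT gt_eqF//; lia.
    + by rewrite jumpE eqxx (negbTE h0) E gt_eqF//; lia.
    + move=> y yr; rewrite !jumpE (negbTE yr) e1 E.
      by case: eqVneq => // ?; exact: heq.
    + move=> y ry; rewrite !jumpE gt_eqF; last by lia.
      rewrite gt_eqF//; exact: hR.
    + move=> y yr; rewrite !jumpE (lt_eqF yr) E.
      by case: eqVneq => // ?; exact: hL.
exists r; split; split.
- by rewrite jumpE eq_sym (negbTE xr) eq_sym (negbTE xr1).
- by rewrite jumpE eq_sym (negbTE xr) eq_sym (negbTE xr1).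
- move=> y yr; rewrite !jumpE (heq x xr) (heq _ xr1).
  by do 2 case: ifP => // _; exact: heq.
- move=> y ry; rewrite !jumpE; case: eqVneq => [yx|_].
    by move=> /andP[/hR -> //]; [move=> /hR ->//; lia | lia].
  case: eqVneq => [yx|_]; last exact: hR.
  by move=> /orP[] /hR ->; rewrite ?orbT//; lia.
- move=> y ry; rewrite !jumpE; case: eqVneq => [yx|_].
    by move=> /andP[/hL -> //]; [move=> /hL ->//; lia | lia].
  case: eqVneq => [yx|_]; last exact: hL.
  by move=> /orP[] /hL ->; rewrite ?orbT//; lia.
Qed.

(** * Finite lists of arrows and boxes *)

Section Boxes.
Variable R : realType.
Implicit Types (s : seq (int * R)) (om : set (int * R)) (t : R) (a b x y : int).
Local Notation run s :=
  (fun eta : config => foldl (fun xi (p : int * R) => jump p.1 xi) eta s).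

Lemma run_homo s (eta xi : config) :
  (forall y, eta y -> xi y) -> forall y, run s eta y -> run s xi y.
Proof.
by elim: s eta xi => //= p s IH eta xi le; apply: IH => y; exact: jump_homo.
Qed.

Lemma run_crosses s (r : int) (xi1 xi0 zeta : config) :
  differ_only_at r xi1 xi0 -> crosses_at r xi0 zeta ->
  exists r', differ_only_at r' (run s xi1) (run s xi0) /\
             crosses_at r' (run s xi0) (run s zeta).
Proof.
elim: s r xi1 xi0 zeta => [|p s IH] r xi1 xi0 zeta h1 h2 /=; first by exists r.
have [r' [h1' h2']] := jump_crosses p.1 h1 h2.
exact: IH h1' h2'.
Qed.

Lemma run_outside s a b (eta : config) y :
  (forall p, p \in s -> a < p.1 < b) -> ~~ (a < y <= b) -> run s eta y = eta y.
Proof.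
move=> + yab; elim: s eta => //= p s IH eta sab.
rewrite IH => [|q qs]; last by apply: sab; rewrite inE qs orbT.
have := sab p (mem_head _ _); rewrite jumpE => pab.
by rewrite !ifF//; apply/negbTE; lia.
Qed.

(** An arrow that is neither inside the box nor at one of its boundary sites
[a], [b] has both endpoints outside the box. *)
Lemma run_filter s a b (eta xi : config) :
  (forall p, p \in s -> p.1 != a /\ p.1 != b) ->
  (forall y, a < y <= b -> eta y = xi y) ->
  forall y, a < y <= b ->
    run s eta y = run [seq p <- s | a < p.1 < b] xi y.
Proof.
elim: s eta xi => [|[q r] s IH] eta xi sab e y yab /=; first exact: e.
have /= [qa qb] := sab (q, r) (mem_head _ _).
have sab' p : p \in s -> p.1 != a /\ p.1 != b.
  by move=> ps; apply: sab; rewrite inE ps orbT.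
case: ifPn => qab /=; apply: IH => // z zab; rewrite !jumpE.
- by rewrite !e//; lia.
- rewrite ifF; last by apply/negbTE; lia.
  by rewrite ifF; [exact: e | apply/negbTE; lia].
Qed.

(** Quiet sites are required arbitrarily far on both sides so that finitely
many sites and boxes always fit into one larger box. *)
Record regular om t : Prop := {
  quiet_left : forall x, exists2 a, a < x & quiet om t a ;
  quiet_right : forall x, exists2 b, x <= b & quiet om t b ;
  finite_line : forall x, finite_set [set r | om (x, r) /\ 0 < r <= t] ;
  distinct_times : forall x y r, 0 < r <= t -> om (x, r) -> om (y, r) -> x = y }.

Lemma finite_box_arrows om t ab : regular om t -> finite_set (box_arrows om t ab).
Proof.
move=> reg.
apply: (@sub_finite_set _ _ (\bigcup_(i in [set x : int | ab.1 < x < ab.2])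
   (pair i @` [set r | om (i, r) /\ 0 < r <= t]))).
  move=> [x r] /= [omx [xab rt]]; exists x => //=; exists r => //.
apply: bigcup_finite => [|x _].
  apply: (@sub_finite_set _ _ ((fun n : nat => ab.1 + n%:Z) @` `I_(`|ab.2 - ab.1|))).
    by move=> x /= xab; exists `|x - ab.1|%N; lia.
  exact/finite_image/finite_II.
exact/finite_image/finite_line.
Qed.

Lemma mem_box_arrow_seq om t ab p : regular om t ->
  p \in box_arrow_seq om t ab <-> box_arrows om t ab p.
Proof.
move=> reg; rewrite mem_sort in_fset_set; last exact: finite_box_arrows.
by rewrite inE.
Qed.

(** Distinct times make the order by time antisymmetric on the arrows, so that
the sorted list does not depend on how a finite set is enumerated. *)
Lemma box_arrow_seq_filter om t a b A B : regular om t ->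
  A <= a -> b <= B ->
  box_arrow_seq om t (a, b) =
  [seq p <- box_arrow_seq om t (A, B) | a < p.1 < b].
Proof.
move=> reg Aa bB; rewrite /box_arrow_seq filter_sort; last 2 first.
- by move=> p q; exact: le_total.
- by move=> p q r; exact: le_trans.
apply/perm_sort_inP.
- by move=> p q _ _; exact: le_total.
- by move=> p q r _ _ _; exact: le_trans.
- move=> [x r] [y r'].
  rewrite !in_fset_set; try exact: finite_box_arrows.
  rewrite !inE /= => -[/= ox [_ rt]] [/= oy _] /le_anti rr.
  subst r'; congr pair; exact: distinct_times reg _ _ _ rt ox oy.
apply: uniq_perm; first exact: fset_uniq.
  exact/filter_uniq/fset_uniq.
move=> p; rewrite mem_filter !in_fset_set; try exact: finite_box_arrows.
apply/idP/andP.
- rewrite inE => -[/= op [pab pt]]; split=> //; rewrite inE; split=> //=.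
  by split=> //; lia.
- by move=> [pab]; rewrite inE => -[op [_ pt]]; rewrite inE.
Qed.

Lemma run_box om t a b A B (eta : config) y : regular om t ->
  quiet om t a -> quiet om t b -> A <= a -> b <= B -> a < y <= b ->
  run (box_arrow_seq om t (A, B)) eta y = run (box_arrow_seq om t (a, b)) eta y.
Proof.
move=> reg qa qb Aa bB yab.
rewrite (box_arrow_seq_filter reg Aa bB); apply: run_filter => // -[x r].
move=> /(mem_box_arrow_seq _ _ reg)[/= ox [_ rt]].
split; apply/eqP => ex; move: ox; rewrite ex; [exact: qa | exact: qb].
Qed.

Lemma exists_box om t x y : regular om t ->
  exists ab, [/\ quiet om t ab.1, quiet om t ab.2, ab.1 < x <= ab.2 & ab.1 < y <= ab.2].
Proof.
move=> reg.
have [a ha qa] := quiet_left reg (Order.min x y).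
have [b hb qb] := quiet_right reg (Order.max x y).
by exists (a, b); split=> //=; lia.
Qed.

(** Two boxes of the same site need not be nested; both are compared with a
larger one. *)
Lemma tasep_any_box om t ab (eta : config) y : regular om t ->
  quiet om t ab.1 -> quiet om t ab.2 -> ab.1 < y <= ab.2 ->
  tasep eta om t y = run (box_arrow_seq om t ab) eta y.
Proof.
case: ab => a b /= reg qa qb yab.
rewrite /tasep; have : is_box om t y (box om t y).
  by apply: xgetPex; exists (a, b).
case: (box om t y) => c e [/= yce [qc qe]].
have [A hA _] := quiet_left reg (Order.min a c).
have [B hB _] := quiet_right reg (Order.max b e).
by rewrite -(@run_box om t a b A B) -?(@run_box om t c e A B)//; lia.
Qed.

Lemma tasep_homo om t (eta xi : config) y :
  (forall z, eta z -> xi z) -> tasep eta om t y -> tasep xi om t y.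
Proof. by move=> le; exact: run_homo. Qed.

Lemma with_particle_hole_differ (eta : config) :
  differ_only_at 0 (with_particle eta) (with_hole eta).
Proof.
split; rewrite /with_particle /with_hole ?eqxx// => y /negbTE.
by rewrite /with_particle /with_hole => ->.
Qed.

(** The discrepancy found inside a box of the origin cannot leave this box,
where the evolution is the one of [tasep]: the set defining the second class
particle is not empty. *)
Lemma tasep_second_class om t (eta : config) : regular om t ->
  tasep (with_particle eta) om t (second_class eta om t)
    != tasep (with_hole eta) om t (second_class eta om t).
Proof.
move=> reg; rewrite /second_class.
set D := [set x | _]; suff : D (xget 0 D) by [].
apply: xgetPex.
have [[a b] /= [qa qb ab0 _]] := @exists_box om t 0 0 reg.
have [r [[r1 r0 _] _]] := run_crosses (box_arrow_seq om t (a, b)) (with_particle_hole_differ eta)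
  (zeta := with_hole eta) (conj (fun _ _ h => h) (fun _ _ h => h)).
exists r; have abr : a < r <= b.
  apply/contraT => rab; have rn0 : r != 0 by apply: contraNneq rab => ->.
  move: r1 r0; rewrite /= !(@run_outside _ a b)//.
  - by rewrite /with_particle /with_hole (negbTE rn0) => ->.
  - by move=> p /(mem_box_arrow_seq _ _ reg)[_ []].
  - by move=> p /(mem_box_arrow_seq _ _ reg)[_ []].
by rewrite /D /= !(@tasep_any_box om t (a, b))// r1 (negbTE r0).
Qed.

(** All values are computed in a box of both [x] and the second class
particle. Off its second class particle, the evolution of [eta] agrees with
the one of [with_hole eta], whatever [eta] holds at the origin. *)
Lemma tasep_crosses om t (eta zeta : config) : regular om t ->
  crosses_at 0 eta zeta ->
  crosses_at (second_class eta om t) (tasep eta om t) (tasep zeta om t).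
Proof.
move=> reg [hR hL].
have hS := tasep_second_class eta reg.
set S := second_class eta om t in hS *.
suff H : forall x, (S < x -> tasep zeta om t x -> tasep eta om t x) /\
   (x < S -> tasep eta om t x -> tasep zeta om t x).
  by split=> x; case: (H x).
move=> x; have [ab [qa qb abS abx]] := @exists_box om t S x reg.
move: hS; rewrite !(@tasep_any_box om t ab)//.
have c0 : crosses_at 0 (with_hole eta) zeta.
  split=> y y0; rewrite /with_hole.
    by rewrite gt_eqF//; exact: hR.
  by rewrite lt_eqF//; exact: hL.
have [r [[r1 r0 rd] [rR rL]]] :=
  run_crosses (box_arrow_seq om t ab) (with_particle_hole_differ eta) c0.
move=> hS; have Sr : S = r by apply/eqP; apply: contraT => /rd /eqP; rewrite (negbTE hS).
have eqx : x != S -> run (box_arrow_seq om t ab) eta x =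
   run (box_arrow_seq om t ab) (with_hole eta) x.
  move=> xS; rewrite Sr in xS.
  have [e0|e0] := boolP (eta 0).
    rewrite -(rd _ xS); congr (foldl _ _ _ _); apply/funext => y.
    by rewrite /with_particle; case: eqVneq => // ->.
  congr (foldl _ _ _ _); apply/funext => y.
  by rewrite /with_hole; case: eqVneq => // ->; apply/negbTE.
split=> [Sx|xS].
  by rewrite eqx ?gt_eqF//; apply: rR; rewrite -Sr.
by rewrite eqx ?lt_eqF//; apply: rL; rewrite -Sr.
Qed.

End Boxes.

(** * Null sets *)

Section AlmostSurely.
Context (R : realType) (d : measure_display) (T : measurableType d).
Variable P : probability T R.

Lemma ae_forall_countable (I : countType) (Q : I -> T -> Prop) :
  (forall i, {ae P, forall w, Q i w}) -> {ae P, forall w, forall i, Q i w}.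
Proof.
move=> h.
have : {ae P, forall w, forall n, if choice.unpickle n is Some i then Q i w else True}.
  by apply: ae_foralln => n; case: (choice.unpickle n) => [i|]; [exact: h|exact: aeW].
by apply: filterS => w hw i; have := hw (choice.pickle i); rewrite choice.pickleK.
Qed.

(** Covers of small measure avoid any measurability question about [A]
itself. *)
Lemma negligible_small_cover (A : set T) :
  (forall e : R, 0 < e ->
     exists E, [/\ measurable E, A `<=` E & (P E <= e%:E)%E]) ->
  P.-negligible A.
Proof.
move=> h.
have /choice[E hE] : forall n : nat, exists E : set T,
   [/\ measurable E, A `<=` E & (P E <= (n.+1%:R^-1)%:E)%E].
  by move=> n; apply: h; rewrite invr_gt0.
have mE : measurable (\bigcap_n E n).
  by apply: bigcapT_measurable => n; case: (hE n).
exists (\bigcap_n E n); split => //; last first.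
  by move=> w Aw n _; case: (hE n) => _ + _; exact.
apply/eqP; rewrite eq_le measure_ge0 andbT; apply/lee_addgt0Pr => e e0.
rewrite add0e.
have [n _ /(_ n (leqnn n)) ne] := near_infty_natSinv_lt (PosNum e0).
apply: (@le_trans _ _ (P (E n))).
  by apply: le_measure; rewrite ?inE//; [case: (hE n) | exact: bigcap_inf].
case: (hE n) => _ _ /le_trans; apply; rewrite lee_fin; exact: ltW.
Qed.

(** * One Poisson line *)

Section Line.
Variable pts : T -> set R.
Hypothesis hpts : rate1_poisson P pts.

Definition has_point (B : set R) : set T := ~` [set w | npoints pts B w = 0%:R%:E].

Lemma has_pointP (B : set R) (s : R) w : pts w s -> B s -> has_point B w.
Proof.
move=> ps Bs; rewrite /has_point /npoints /counting /=.
case: asboolP => [fin /= -[] /eqP|//].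
rewrite pnatr_eq0 cardfs_eq0 => /eqP e.
have : s \in fset_set (pts w `&` B) by rewrite in_fset_set// inE.
by rewrite e.
Qed.

Lemma borel_pos_itv (a b : R) : 0 <= a -> borel_pos `[a, b[%classic.
Proof.
move=> a0; split; first exact: measurable_itv.
by move=> s /=; rewrite in_itv /= => /andP[as_ _]; exact: le_trans as_.
Qed.

Lemma measurable_npoints (B : set R) (r : \bar R) : borel_pos B ->
  measurable [set w | npoints pts B w = r].
Proof.
move=> hB; rewrite -[X in measurable X]setTI.
exact: (poisson_meas hpts hB measurableT (emeasurable_set1 r)).
Qed.

Lemma measurable_has_point (B : set R) : borel_pos B -> measurable (has_point B).
Proof. by move=> hB; apply/measurableC/measurable_npoints. Qed.

Lemma sigma_points_has_point (B : set R) : borel_pos B -> sigma_points pts (has_point B).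
Proof.
move=> hB; apply: sub_sigma_algebra; exists B => //.
exists (~` [set 0%:R%:E]); first exact/measurableC/emeasurable_set1.
by rewrite setTI.
Qed.

Lemma lebesgue_itv (a b : R) : a <= b ->
  lebesgue_measure `[a, b[%classic = (b - a)%:E.
Proof.
move=> ab; rewrite lebesgue_measure_itv /= lte_fin.
case: ifPn => [_|]; first by rewrite EFinB.
by rewrite -leNgt => ba; rewrite (@le_anti _ _ a b) ?subrr ?ab.
Qed.

Lemma probability_has_point (a b : R) : 0 <= a -> a <= b ->
  P (has_point `[a, b[%classic) = (1 - expR (- (b - a)))%:E.
Proof.
move=> a0 ab; have hB := borel_pos_itv b a0.
rewrite /has_point probability_setC; last exact: measurable_npoints.
rewrite (poisson_law hpts hB) lebesgue_itv ?ltry//=.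
by rewrite expr0 fact0 divr1 mulr1 EFinB.
Qed.

(** The counting measure of an infinite set is [+oo], and the events that it
equals a given natural number exhaust the total mass. *)
Lemma ae_finite_points (b : R) : 0 < b ->
  {ae P, forall w, finite_set (pts w `&` `[0, b[%classic)}.
Proof.
move=> b0; have hB := @borel_pos_itv 0 b (lexx _).
set N := npoints pts `[0, b[%classic.
set F : nat -> set T := fun k => [set w | N w = k%:R%:E].
have mF k : measurable (F k) by exact: measurable_npoints.
have tF : trivIset setT F.
  move=> i j _ _ [w [Fi Fj]].
  have [/eqP] : i%:R%:E = j%:R%:E :> \bar R by rewrite -Fi -Fj.
  by rewrite eqr_nat => /eqP.
exists (~` \bigcup_k F k); split.
- by apply: measurableC; exact: bigcupT_measurable.
- rewrite probability_setC; last exact: bigcupT_measurable.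
  rewrite measure_bigcup//.
  suff -> : (\sum_(0 <= k <oo | k \in setT) P (F k) = 1)%E by rewrite subee.
  (* Reading [1] as the total mass of the Poisson law reduces the claim to an
     equality of terms. *)
  rewrite -(@probability_setT _ _ _ (poisson_prob b 0)) /= /poisson_prob b0.
  rewrite -nneseries_esumT; last first.
    by move=> n; rewrite lee_fin poisson_pmf_ge0.
  rewrite (eq_eseriesl (Q := xpredT)) => [|k]; last by rewrite in_setT.
  apply: eq_eseriesr => k _.
  rewrite (poisson_law hpts hB) lebesgue_itv ?ltry ?ltW//= subr0.
  by rewrite /poisson_pmf b0 -mulrA mulrC.
- move=> w /=; apply: contra_not => -[k _]; rewrite /F /N /= /npoints /counting.
  by case: asboolP.
Qed.

End Line.

(** * Regularity of the arrows *)

Section Arrows.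
Variable om : T -> set (int * R).
Hypothesis hom : poisson_arrows P om.

Local Notation arrow_in x B := (has_point (line om x) B).

(** The probability that [n] distinct lines all carry an arrow before time
[N + 1] is the [n]-th power of a number below one. *)
Lemma ae_exists_quiet (N : nat) (f : nat -> int) : injective f ->
  {ae P, forall w, exists i, quiet (om w) N%:R (f i)}.
Proof.
move=> finj; set B : set R := `[0, N.+1%:R[%classic.
have hB : borel_pos B by exact: borel_pos_itv.
pose c : R := 1 - expR (- N.+1%:R).
have c0 : 0 <= c by rewrite subr_ge0 -expR0 ler_expR oppr_le0.
have c1 : c < 1 by rewrite ltrBlDr ltrDl expR_gt0.
apply: negligible_small_cover => e e0.
have : (fun n => c ^+ n) @ \oo --> 0 by apply: cvg_expr; rewrite ger0_norm.
move=> /cvgr_lt /(_ e e0)[n _ /(_ n (leqnn n)) /= cn].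
pose J : {fset int} := [fset x in [seq f i | i <- iota 0 n]]%fset.
pose E := \bigcap_(x in [set` J]) arrow_in x B.
exists E; split.
- apply: fin_bigcap_measurable => [|x _]; first exact: finite_fset.
  exact: (measurable_has_point (arrows_poisson hom x) hB).
- move=> w /= nq x; rewrite /= !inE => /mapP[i _ ->]; apply: contra_notP nq => /= nh.
  exists i => s s0 os; apply: nh; apply: (has_pointP os).
  by rewrite /B /= in_itv /= (ltW (andP s0).1) (le_lt_trans (andP s0).2)// ltr_nat.
- rewrite (arrows_indep hom) => [|x _]; last exact: sigma_points_has_point.
  rewrite (eq_bigr (fun=> c%:E)) => [|x _]; last first.
    rewrite (probability_has_point (arrows_poisson hom x))// subr0//.
  rewrite prodEFin big_const_seq count_predT iter_mulr_1 lee_fin.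
  have -> : size J = n.
    by rewrite card_fseq undup_id ?size_map ?size_iota// map_inj_uniq ?iota_uniq.
  exact: ltW.
Qed.

(** Among the [N * M + 1] pieces of length [1 / M] needed to reach time [N],
each contains points of both lines with probability at most [1 / M ^ 2]. *)
Lemma ae_no_simultaneous (N : nat) (x y : int) : x != y ->
  {ae P, forall w, forall s, 0 <= s <= N%:R ->
     om w (x, s) -> om w (y, s) -> False}.
Proof.
move=> xy; apply: negligible_small_cover => e e0.
have [n _ /(_ n (leqnn n)) /= ne] :=
  near_infty_natSinv_lt (PosNum (divr_gt0 e0 (ltr0Sn R N))).
pose M := n.+1; pose B k : set R := `[k%:R / M%:R, k.+1%:R / M%:R[%classic.
have M0 : 0 < M%:R :> R by rewrite ltr0n.
have hB k : borel_pos (B k) by apply: borel_pos_itv; rewrite divr_ge0.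
pose H k := arrow_in x (B k) `&` arrow_in y (B k).
have mh z k : measurable (arrow_in z (B k)).
  exact: (measurable_has_point (arrows_poisson hom z)).
have mH k : measurable (H k) by exact: measurableI.
have PH k : (P (H k) <= (M%:R^-1 ^+ 2)%:E)%E.
  have -> : H k = \bigcap_(z in [set` [fset x; y]%fset]) arrow_in z (B k).
    apply/seteqP; split=> [w [hx hy] z /= | w hw].
      by rewrite !inE => /orP[] /eqP ->.
    by split; apply: hw; rewrite /= !inE eqxx ?orbT.
  rewrite (arrows_indep hom) => [|z _]; last exact: sigma_points_has_point.
  rewrite big_fsetU1 ?inE//= big_seq_fset1 expr2 EFinM.
  have hz z : (P (arrow_in z (B k)) <= (M%:R^-1)%:E)%E.
    rewrite (probability_has_point (arrows_poisson hom z)) ?divr_ge0//; last first.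
      by rewrite ler_pM2r ?invr_gt0// ler_nat.
    rewrite lee_fin -mulrBl -natrB// subSnn mul1r.
    by have := expR_ge1Dx (- M%:R^-1 : R); lra.
  by apply: lee_pmul => //; exact: hz.
exists (\big[setU/set0]_(k < (N * M).+1) H k); split.
- exact: bigsetU_measurable.
- move=> w /existsNP[s] /not_implyP[/andP[s0 sN]] /not_implyP[ox] /not_implyP[oy _].
  (* Integer parts locate [s] in a piece closed on the left, which is why all
     pieces have this shape. *)
  rewrite -bigcup_mkord; exists (Num.truncn (s * M%:R)) => /=.
    rewrite ltnS -(ler_nat R) natrM; apply: le_trans (_ : s * M%:R <= _).
      by rewrite truncn_le mulr_ge0.
    by rewrite ler_pM2r.
  have Bs : B (Num.truncn (s * M%:R)) s.
    rewrite /B /= in_itv /= ler_pdivrMr// ltr_pdivlMr//.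
    by apply: truncn_itv; rewrite mulr_ge0// ltW.
  by split; [exact: has_pointP ox Bs | exact: has_pointP oy Bs].
- apply: le_trans (Boole_inequality _ _) _ => //.
  apply: (@le_trans _ _ (\sum_(k < (N * M).+1) ((M%:R^-1) ^+ 2)%:E)%E).
    apply: lee_sum => k _.
    exact: PH.
  rewrite sumEFin lee_fin sumr_const card_ord -[_ *+ _]mulr_natr.
  have Mi0 : 0 < M%:R^-1 :> R by rewrite invr_gt0.
  apply: (@le_trans _ _ (N.+1%:R * M%:R^-1)); last first.
    by rewrite mulrC -ler_pdivlMr ?ltr0n// ltW.
  rewrite expr2 -mulrA mulrC ler_pM2r// mulrC ler_pdivrMr// -natrM ler_nat.
  by rewrite /M; nia.
Qed.

(** It is enough to treat integer times, since regularity up to a later time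
implies regularity up to [t]. *)
Lemma ae_regular : {ae P, forall w, forall t, regular (om w) t}.
Proof.
have hQ : {ae P, forall w, forall p : nat * int,
    (exists i : nat, quiet (om w) p.1%:R (p.2 - i.+1%:Z)) /\
    (exists i : nat, quiet (om w) p.1%:R (p.2 + i%:Z))}.
  apply: ae_forall_countable => -[N x].
  have h1 := @ae_exists_quiet N (fun i => x - i.+1%:Z) ltac:(move=> i j /=; lia).
  have h2 := @ae_exists_quiet N (fun i => x + i%:Z) ltac:(move=> i j /=; lia).
  by move: h1 h2; apply: filterS2.
have hF : {ae P, forall w, forall p : nat * int,
    finite_set (line om p.2 w `&` `[0, p.1.+1%:R[%classic)}.
  apply: ae_forall_countable => p.
  exact: (ae_finite_points (arrows_poisson hom p.2)).
have hD : {ae P, forall w, forall p : nat * (int * int), p.2.1 != p.2.2 ->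
    forall s, 0 <= s <= p.1%:R ->
     om w (p.2.1, s) -> om w (p.2.2, s) -> False}.
  apply: ae_forall_countable => p.
  have [->|xy] := eqVneq p.2.1 p.2.2; first by apply: aeW.
  have := ae_no_simultaneous p.1 xy.
  by apply: filterS => w h _; exact: h.
move: hQ hF hD; apply: filterS3 => w hQ hF hD t.
pose N := (Num.truncn t).+1.
have tN s : 0 < s <= t -> 0 < s <= N%:R.
  move=> /andP[s0 st]; rewrite s0 (le_trans st)// ltW//.
  exact: truncnS_gt.
split.
- move=> x; have [[i /= hi] _] := hQ (N, x).
  by exists (x - i.+1%:Z); [lia | move=> s /tN; exact: hi].
- move=> x; have [_ [i /= hi]] := hQ (N, x).
  by exists (x + i%:Z); [lia | move=> s /tN; exact: hi].
- move=> x; apply: sub_finite_set (hF (N, x)) => s [os /tN /andP[s0 sN]].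
  split=> //=; rewrite in_itv /= (ltW s0) (le_lt_trans sN)// ltr_nat//.
- move=> x y s /tN /andP[s0 sN] ox oy; apply/eqP/contraT => xy.
  by case: (hD (N, (x, y)) xy s) => //; rewrite (ltW s0).
Qed.

End Arrows.

(** * Initial values and conclusion *)

Lemma ae_uniform_neq (U : int -> {RV P >-> R}) (c : R) : iid_uniform U ->
  {ae P, forall w, forall x, U x w != c}.
Proof.
move=> hU; apply: ae_forall_countable => x.
exists (U x @^-1` [set c]); split.
- by rewrite -[X in measurable X]setTI; exact: measurable_funP.
- have := uniform_law hU x (measurable_set1 c); rewrite /distribution /pushforward => ->.
  have /(dominates_uniform_prob (@ltr01 R)) null : lebesgue_measure.-null_set [set c].
    apply/measure0_null_setP; [exact: measurable_set1 | exact: lebesgue_measure_set1].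
  by apply: null => //; exact: measurable_set1.
- by move=> w /= /negP; rewrite negbK => /eqP.
Qed.

End AlmostSurely.

Unset Implicit Arguments.
Unset Strict Implicit.

Theorem lemma9p1 (R : realType) (d : measure_display) (T : measurableType d)
    (P : probability T R) (U : int -> {RV P >-> R})
    (om : T -> set (int * R))
    (hU : iid_uniform U) (hom : poisson_arrows P om)
    (hUom : independent2 P (sigma_uniforms U) (sigma_arrows om))
    (lambda rho : R) (hrho : 0 <= rho) (hlt : rho < lambda)
    (hlambda : lambda <= 1) :
  {ae P, forall w : T,
     let u := fun x : int => U x w in
     let eta (alpha : R) := tasep (eta_hom u alpha) (om w) in
     let eta_lr := tasep (eta_step u lambda rho) (om w) in
     let S (alpha : R) := second_class (eta_hom u alpha) (om w) in
     forall (t : R) (x : int), 0 <= t ->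
       (S rho t < x -> eta_lr t x = eta rho t x) /\
       (x < S lambda t -> eta_lr t x = eta lambda t x)} /\
  (forall alpha : R, rho <= alpha <= lambda ->
   {ae P, forall w : T,
     let u := fun x : int => U x w in
     let eta := tasep (eta_hom u alpha) (om w) in
     let eta_lr := tasep (eta_step u lambda rho) (om w) in
     let S := second_class (eta_hom u alpha) (om w) in
     forall (t : R) (x : int), 0 <= t ->
       (S t < x -> (eta_lr t x <= eta t x)%N) /\
       (x < S t -> (eta t x <= eta_lr t x)%N)}).
Proof.
have hreg := ae_regular hom.
have hr := ae_uniform_neq rho hU; have hl := ae_uniform_neq lambda hU.
have crossing (alpha : R) w : (forall x, U x w != rho) -> rho <= alpha <= lambda ->
    crosses_at 0 (eta_hom (fun x => U x w) alpha)
                 (eta_step (fun x => U x w) lambda rho).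
  move=> neq /andP[ra al]; rewrite /eta_hom /eta_step; split=> x x0.
    rewrite leNgt x0 /= le_eqVlt (negbTE (neq x)) /= => /lt_le_trans; exact.
  by rewrite ltW// => /ltW /le_trans; exact.
split.
- move: hreg hr hl; apply: filterS3 => w reg nr nl t x _.
  have hrr : rho <= rho <= lambda by rewrite lexx ltW.
  have hll : rho <= lambda <= lambda by rewrite lexx ltW.
  have [cr _] := tasep_crosses (reg t) (crossing rho w nr hrr).
  have [_ cl] := tasep_crosses (reg t) (crossing lambda w nr hll).
  split=> hx; apply/idP/idP.
  + exact: cr hx.
  + apply: tasep_homo => y; rewrite /eta_hom /eta_step.
    by case: ifP => _ /ltW // /le_trans; apply; exact: ltW.
  + apply: tasep_homo => y; rewrite /eta_hom /eta_step.
    case: ifP => _; first by rewrite le_eqVlt (negbTE (nl y)).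
    by move=> /le_lt_trans; exact.
  + exact: cl hx.
- move=> alpha hal; move: hreg hr; apply: filterS2 => w reg nr t x _.
  have [cr cl] := tasep_crosses (reg t) (crossing alpha w nr hal).
  by split=> [/cr|/cl]; case: (tasep _ _ _ _) => // ->.
Qed.
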